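(* Let $a,b$ be free random variables in a non-commutative probability space $(\mathcal{A},\varphi)$, both with free Poisson distribution of parameter $1$ (i.e. $\kappa_n(a)=\kappa_n(b)=1$ for all $n\ge1$), and let $\nu$ be the distribution of $ab+ba$. Then the compositional inverse of the moment series $M_\nu(z)=\sum_{n=1}^{\infty}\varphi\big((ab+ba)^n\big)z^n$ of $\nu$ is given by $$M_\nu^{\langle -1\rangle}(z)=\frac{-7z-6+3\sqrt{(z+2)(9z+2)}}{4(z+2)^2(z+1)}.$$
   Context: A non-commutative probability space $(\mathcal{A},\varphi)$ is a unital algebra over $\mathbb{C}$ with a linear functional $\varphi$, $\varphi(1)=1$. The free cumulants are the multilinear functionals $\kappa_n:\mathcal{A}^n\to\mathbb{C}$ determined recursively by $\varphi(a_1\cdots a_n)=\sum_{\pi\in\mathcal{NC}(n)}\prod_{V\in\pi}\kappa_{|V|}(a_V)$, where $\mathcal{NC}(n)$ is the set of non-crossing partitions of $\{1,\dots,n\}$ and for $V=\{v_1<\dots<v_k\}$, $\kappa_{|V|}(a_V)=\kappa_k(a_{v_1},\dots,a_{v_k})$; $\kappa_n(a):=\kappa_n(a,\dots,a)$. Freeness is free independence, equivalently vanishing of mixed free cumulants in $a,b$. $M_\nu$ is a formal power series with zero constant term and nonzero linear coefficient, and $M_\nu^{\langle -1\rangle}$ is its inverse under composition of formal power series. The right-hand side is understood as a formal power series in $z$, with $\sqrt{(z+2)(9z+2)}$ the square root with constant term $+2$. *)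

(* Defs.v *)
From HB Require Import structures.
From mathcomp Require Import all_boot all_order all_algebra.
From mathcomp Require Import boolp reals complex.

Set Implicit Arguments.
Unset Strict Implicit.
Unset Printing Implicit Defensive.

Import Order.TTheory GRing.Theory Num.Theory.
Local Open Scope ring_scope.

Record fps (F : fieldType) := Fps { fcoef :> nat -> F }.

HB.instance Definition _ (F : fieldType) := [isNew for @fcoef F].
HB.instance Definition _ (F : fieldType) := gen_eqMixin (fps F).
HB.instance Definition _ (F : fieldType) := gen_choiceMixin (fps F).

Section FpsRing.
Variable F : fieldType.
Implicit Types f g h : fps F.

Lemma fpsP f g : (forall n, f n = g n) <-> f = g.
Proof.
split=> [|-> //]; case: f g => [f] [g] /= fg; congr Fps; exact/funext.
Qed.

Definition fps_const (c : F) : fps F := Fps (fun n => if n is 0 then c else 0).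
Definition fps_add f g : fps F := Fps (fun n => f n + g n).
Definition fps_opp f : fps F := Fps (fun n => - f n).
Definition fps_mul f g : fps F :=
  Fps (fun n => \sum_(i < n.+1) f i * g (n - i)%N).

Fact fps_addA : associative fps_add.
Proof. by move=> f g h; apply/fpsP => n /=; rewrite addrA. Qed.
Fact fps_addC : commutative fps_add.
Proof. by move=> f g; apply/fpsP => n /=; rewrite addrC. Qed.
Fact fps_add0 : left_id (fps_const 0) fps_add.
Proof. by move=> f; apply/fpsP => -[|n] /=; rewrite add0r. Qed.
Fact fps_addN : left_inverse (fps_const 0) fps_opp fps_add.
Proof. by move=> f; apply/fpsP => -[|n] /=; rewrite addNr. Qed.

HB.instance Definition _ :=
  GRing.isZmodule.Build (fps F) fps_addA fps_addC fps_add0 fps_addN.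

Definition fps_trunc n f : {poly F} := \poly_(i < n) f i.

Lemma fps_mul_trunc n m f g :
  (n < m)%N -> fps_mul f g n = (fps_trunc m f * fps_trunc m g)`_n.
Proof.
move=> ltnm; rewrite coefM /=; apply: eq_bigr => i _.
have ltim : (i < m)%N by apply: leq_ltn_trans ltnm; rewrite -ltnS.
by rewrite !coef_poly ltim (leq_ltn_trans (leq_subr _ _) ltnm).
Qed.

Fact fps_mulC : commutative fps_mul.
Proof.
move=> f g; apply/fpsP => n.
by rewrite !(@fps_mul_trunc n n.+1) // mulrC.
Qed.

Fact fps_mulA : associative fps_mul.
Proof.
move=> f g h; apply/fpsP => n.
have E u v w : fps_mul u (fps_mul v w) n
    = (fps_trunc n.+1 u * (fps_trunc n.+1 v * fps_trunc n.+1 w))`_n.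
  rewrite coefM [LHS]/=; apply: eq_bigr => i _.
  rewrite coef_poly ltn_ord; congr (_ * _).
  by apply: fps_mul_trunc; rewrite ltnS leq_subr.
by rewrite E [fps_mul (fps_mul _ _) _]fps_mulC E mulrA mulrC.
Qed.

Fact fps_mul1 : left_id (fps_const 1) fps_mul.
Proof.
move=> f; apply/fpsP => n /=; rewrite big_ord_recl subn0 mul1r big1 ?addr0 //.
by move=> i _; rewrite mul0r.
Qed.

Fact fps_mulDl : left_distributive fps_mul fps_add.
Proof.
move=> f g h; apply/fpsP => n /=; rewrite -big_split /=.
by apply: eq_bigr => i _; rewrite mulrDl.
Qed.

Fact fps_1neq0 : fps_const 1 != 0.
Proof. by apply/eqP => /fpsP/(_ 0%N)/= /eqP; rewrite oner_eq0. Qed.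

HB.instance Definition _ := GRing.Zmodule_isComNzRing.Build (fps F)
  fps_mulA fps_mulC fps_mul1 fps_mulDl fps_1neq0.

Lemma coef_fpsD f g n : (f + g) n = f n + g n. Proof. by []. Qed.
Lemma coef_fpsN f n : (- f) n = - f n. Proof. by []. Qed.
Lemma coef_fpsM f g n : (f * g) n = \sum_(i < n.+1) f i * g (n - i)%N.
Proof. by []. Qed.
Lemma coef_fps1 n : (1 : fps F) n = (n == 0%N)%:R. Proof. by case: n. Qed.
Lemma coef_fps0 n : (0 : fps F) n = 0. Proof. by case: n. Qed.

(* Course-of-values recursion: the n-th coefficient is obtained by applying *)
(* [step] to the list of the coefficients of index 0, ..., n - 1.           *)
Fixpoint fps_prefix (step : seq F -> F) n : seq F :=
  if n is m.+1 then let s := fps_prefix step m in rcons s (step s) else [::].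
Definition fps_rec (step : seq F -> F) : fps F :=
  Fps (fun n => step (fps_prefix step n)).

Lemma size_fps_prefix step n : size (fps_prefix step n) = n.
Proof. by elim: n => //= n IHn; rewrite size_rcons IHn. Qed.

Lemma nth_fps_prefix step n i :
  (i < n)%N -> (fps_prefix step n)`_i = fps_rec step i.
Proof.
elim: n => //= n IHn; rewrite ltnS nth_rcons size_fps_prefix leq_eqVlt.
by case/predU1P=> [->|ltin]; rewrite ?ltnn ?eqxx // ltin IHn.
Qed.

Definition fps_inv_step f (s : seq F) : F :=
  if s is [::] then (f 0%N)^-1
  else - (f 0%N)^-1 * \sum_(i < size s) f (size s - i)%N * s`_i.

Definition fps_unit : {pred fps F} := fun f => f 0%N != 0.
Definition fps_inv f : fps F :=
  if f 0%N == 0 then f else fps_rec (fps_inv_step f).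

Fact fps_mulVx : {in fps_unit, left_inverse 1 fps_inv *%R}.
Proof.
move=> f f0; apply/fpsP => n; rewrite coef_fpsM coef_fps1 /fps_inv.
rewrite -topredE /= /fps_unit in f0; rewrite (negbTE f0).
set g := fps_rec _; case: n => [|n]; first by rewrite big_ord1 mulVf.
have -> : \sum_(i < n.+2) g i * f (n.+1 - i)%N
    = \sum_(i < n.+1) g i * f (n.+1 - i)%N + g n.+1 * f 0%N.
  by rewrite big_ord_recr subnn.
have -> : g n.+1 = - (f 0%N)^-1 * \sum_(i < n.+1) g i * f (n.+1 - i)%N.
  have -> : g n.+1 = fps_inv_step f (fps_prefix (fps_inv_step f) n.+1) by [].
  rewrite /fps_inv_step; case E: fps_prefix => [|x t].
    by move: (size_fps_prefix (fps_inv_step f) n.+1); rewrite E.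
  rewrite -E size_fps_prefix; congr (_ * _); apply: eq_bigr => i _.
  by rewrite nth_fps_prefix // mulrC.
by rewrite mulrAC mulNr mulVf // mulN1r addrN.
Qed.

Fact fps_unitPl f g : g * f = 1 -> fps_unit f.
Proof.
move=> /fpsP/(_ 0%N); rewrite coef_fpsM coef_fps1 big_ord1 /fps_unit => E.
by apply/eqP => f0; move/eqP: E; rewrite f0 mulr0 eq_sym oner_eq0.
Qed.

Fact fps_invr_out : {in [predC fps_unit], fps_inv =1 id}.
Proof.
move=> f; rewrite inE -topredE /= /fps_unit negbK /fps_inv.
by move=> ->.
Qed.

HB.instance Definition _ := GRing.ComNzRing_hasMulInverse.Build (fps F)
  fps_mulVx fps_unitPl fps_invr_out.

Lemma fps_unitE f : (f \is a GRing.unit) = (f 0%N != 0).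
Proof. by []. Qed.

Definition fpsX : fps F := Fps (fun n => (n == 1%N)%:R).

(* Composition f(g(z)); it is meaningful when g has zero constant term, in  *)
(* which case g ^+ k does not contribute to the coefficient of z^n, k > n.  *)
Definition fps_comp f g : fps F :=
  Fps (fun n => \sum_(k < n.+1) f k * (g ^+ k) n).

Definition fps_comp_inverse f g : Prop :=
  [/\ f 0%N = 0, g 0%N = 0, fps_comp f g = fpsX & fps_comp g f = fpsX].

(* The square root of f with constant term c, where c ^+ 2 = f 0 and        *)
(* 2 * c != 0; see fps_sqrt_sqr and fps_sqrt_uniq.                          *)
Definition fps_sqrt_step c f (s : seq F) : F :=
  if s is [::] then c
  else (f (size s) - \sum_(1 <= i < size s) s`_i * s`_(size s - i)) / (2 * c).
Definition fps_sqrt c f : fps F := fps_rec (fps_sqrt_step c f).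

Lemma fps_sqrt0 c f : fps_sqrt c f 0%N = c.
Proof. by []. Qed.

Lemma fps_sqrt_sqr c f :
  2 * c != 0 -> c ^+ 2 = f 0%N -> fps_sqrt c f ^+ 2 = f.
Proof.
move=> c2 cf; apply/fpsP => n; rewrite expr2 coef_fpsM.
case: n => [|n]; first by rewrite big_ord1 fps_sqrt0 -expr2.
set g := fps_sqrt c f.
have gE : g n.+1 = (f n.+1 - \sum_(1 <= i < n.+1) g i * g (n.+1 - i)%N)
                   / (2 * c).
  have -> : g n.+1
      = fps_sqrt_step c f (fps_prefix (fps_sqrt_step c f) n.+1) by [].
  rewrite /fps_sqrt_step; case E: fps_prefix => [|x t].
    by move: (size_fps_prefix (fps_sqrt_step c f) n.+1); rewrite E.
  rewrite -E size_fps_prefix; congr ((_ - _) / _).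
  rewrite big_nat [RHS]big_nat; apply: eq_bigr => -[//|i] /andP[_ lti].
  rewrite !nth_fps_prefix //.
  by rewrite subSS (leq_ltn_trans (leq_subr _ _)).
have -> : \sum_(i < n.+2) g i * g (n.+1 - i)%N
    = c * g n.+1 + \sum_(1 <= i < n.+1) g i * g (n.+1 - i)%N + g n.+1 * c.
  rewrite -(big_mkord xpredT (fun i => g i * g (n.+1 - i)%N)).
  by rewrite big_nat_recr // big_ltn // subn0 subnn.
rewrite addrAC [g n.+1 * c]mulrC -mulrDl.
have -> : c + c = 2 * c by rewrite mulr_natl mulr2n.
by rewrite gE mulrC divfK // subrK.
Qed.

Lemma fps_sqrt_uniq c f g :
  2 * c != 0 -> c ^+ 2 = f 0%N -> g ^+ 2 = f -> g 0%N = c -> g = fps_sqrt c f.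
Proof.
move=> c2 cf gf g0; set h := fps_sqrt c f.
have hU : g + h \is a GRing.unit.
  rewrite fps_unitE coef_fpsD g0 fps_sqrt0.
  by rewrite (_ : c + c = 2 * c) // mulr_natl mulr2n.
have : (g - h) * (g + h) = 0 by rewrite -subr_sqr gf fps_sqrt_sqr // subrr.
move/(congr1 (fun u => u / (g + h))); rewrite mulrK // mul0r.
by move/eqP; rewrite subr_eq0 => /eqP.
Qed.

End FpsRing.

Arguments fpsX {F}.

(* A partition of 'I_n is non-crossing when no i < j < k < l have i, k in    *)
(* one block and j, l in a different one.                                   *)
Definition noncrossing n (P : {set {set 'I_n}}) : bool :=
  partition P [set: 'I_n] &&
  [forall V in P, forall W in P,
     forall i in V, forall j in W, forall k in V, forall l in W,
       [&& (i < j)%N, (j < k)%N & (k < l)%N] ==> (V == W)].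

Section FreeProbability.
Variables (F : fieldType) (A : algType F) (phi : {scalar A}).

(* The arguments (a_1, ..., a_n) of a multilinear functional are given as a *)
(* list s of size n; [subargs V] is a_V, listed in increasing order of the  *)
(* indices since [enum 'I_n] is increasing.                                 *)
Definition subargs (s : seq A) (V : {set 'I_(size s)}) : seq A :=
  [seq s`_i | i : 'I_(size s) in V].

(* In the moment-cumulant formula for (a_1, ..., a_n), the only term which  *)
(* involves a cumulant of order n is that of the one-block partition; the   *)
(* other blocks have fewer elements, and the formula is solved recursively. *)
Fixpoint cumulant_rec (m : nat) (s : seq A) : F :=
  if m is m'.+1 then
    phi (\prod_(x <- s) x)
    - \sum_(P : {set {set 'I_(size s)}} | noncrossing P && (P != [set setT]))
        \prod_(V in P) cumulant_rec m' (subargs V)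
  else 0.

(* The value of [free_cumulant] on the empty list is irrelevant.            *)
Definition free_cumulant (s : seq A) : F := cumulant_rec (size s) s.

Lemma size_subargs (s : seq A) (V : {set 'I_(size s)}) : size (subargs V) = #|V|.
Proof. by rewrite size_map -cardE. Qed.

Lemma cumulant_block_small (s : seq A) (P : {set {set 'I_(size s)}}) V :
  noncrossing P -> P != [set setT] -> V \in P -> (#|V| < size s)%N.
Proof.
move=> /andP[/and3P[/eqP covP trivP P0] _] PT VP.
rewrite -[X in (_ < X)%N]card_ord -cardsT proper_card // properT.
apply: contraNneq PT => VT; apply/eqP/setP => W; rewrite inE.
apply/idP/eqP => [WP | ->]; last by rewrite -VT.
apply/eqP; rewrite -VT; apply: contraNT P0 => WV.
have := trivIsetP trivP W V WP VP WV; rewrite VT -setI_eq0 setIT => /eqP <-.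
exact: WP.
Qed.

Lemma cumulant_rec_fuel m s : (size s <= m)%N -> (0 < size s)%N ->
  cumulant_rec m s = free_cumulant s.
Proof.
rewrite /free_cumulant.
have H k : forall m s, (0 < size s <= k)%N -> (size s <= m)%N ->
    cumulant_rec m s = cumulant_rec (size s) s.
  elim: k => [|k IHk] {}m {}s; first by case: size.
  move=> /andP[s0 sk] sm; case: m sm => [|m] sm.
    by rewrite leqn0 in sm; rewrite (eqP sm) in s0.
  case E: (size s) => [|n]; first by rewrite E in s0.
  rewrite [LHS]/= [RHS]/=; congr (_ - _); apply: eq_bigr => P /andP[Pnc PT].
  apply: eq_bigr => V VP; have ltV := cumulant_block_small Pnc PT VP.
  have V0 : (0 < #|V|)%N.
    rewrite card_gt0; apply: contraTneq VP => ->.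
    by case/andP: Pnc => /and3P[].
  have sV := size_subargs V.
  have Vk : (0 < size (subargs V) <= k)%N.
    by rewrite sV V0 -ltnS (leq_trans ltV).
  rewrite !(IHk _ (subargs V)) // sV -ltnS ?(leq_trans ltV) //.
  by rewrite E.
by move=> sm s0; apply: (H (size s)); rewrite ?s0 /=.
Qed.

Lemma noncrossing_full n : noncrossing [set [set: 'I_n.+1]].
Proof.
apply/andP; split; first apply/and3P; first split.
- by rewrite /cover big_set1.
- by apply/trivIsetP => X Y; rewrite !inE => /eqP-> /eqP->; rewrite eqxx.
- by rewrite inE eq_sym -cards_eq0 cardsT card_ord.
apply/forall_inP => V; rewrite inE => /eqP->.
apply/forall_inP => W; rewrite inE => /eqP->.
by do 4![apply/forall_inP => ? _]; rewrite eqxx implybT.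
Qed.

Lemma subargsT (s : seq A) : subargs [set: 'I_(size s)] = s.
Proof.
rewrite /subargs /image_mem.
have -> : enum (mem [set: 'I_(size s)]) = enum 'I_(size s).
  by apply: eq_enum => i; rewrite inE.
by apply: (@eq_from_nth _ 0); rewrite size_map size_enum_ord // => i lti;
   rewrite (nth_map (Ordinal lti)) ?size_enum_ord // nth_enum_ord.
Qed.

Lemma moment_cumulant s : (0 < size s)%N ->
  phi (\prod_(x <- s) x)
  = \sum_(P : {set {set 'I_(size s)}} | noncrossing P)
      \prod_(V in P) free_cumulant (subargs V).
Proof.
move=> s0.
have Tnc : noncrossing [set [set: 'I_(size s)]].
  by case: (size s) s0 => // n _; exact: noncrossing_full.
rewrite (bigD1 [set setT]) //= big_set1 subargsT {1}/free_cumulant.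
case E: {1}(size s) => [|n]; first by rewrite E in s0.
rewrite [X in _ = X + _]/=.
suff -> : \sum_(P : {set {set 'I_(size s)}} | noncrossing P && (P != [set setT]))
            \prod_(V in P) cumulant_rec n (subargs V)
        = \sum_(P : {set {set 'I_(size s)}} | noncrossing P && (P != [set setT]))
            \prod_(V in P) free_cumulant (subargs V) by rewrite subrK.
apply: eq_bigr => P /andP[Pnc PT]; apply: eq_bigr => V VP.
have ltV := cumulant_block_small Pnc PT VP.
apply: cumulant_rec_fuel; rewrite size_subargs.
  by rewrite -ltnS (leq_trans ltV) // E.
rewrite card_gt0; apply: contraTneq VP => ->.
by case/andP: Pnc => /and3P[].
Qed.

Lemma free_cumulant_uniq (kappa : seq A -> F) :
  (forall s, (0 < size s)%N ->
     phi (\prod_(x <- s) x)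
     = \sum_(P : {set {set 'I_(size s)}} | noncrossing P)
         \prod_(V in P) kappa (subargs V)) ->
  forall s, (0 < size s)%N -> kappa s = free_cumulant s.
Proof.
move=> Hk s; move: {2}(size s) (leqnn (size s)) => k.
elim: k s => [|k IHk] s sk s0; first by move: s0; rewrite ltnNge sk.
have Tnc : noncrossing [set [set: 'I_(size s)]].
  by case: (size s) s0 => // n _; exact: noncrossing_full.
have := moment_cumulant s0; rewrite (Hk _ s0).
rewrite (bigD1 [set setT]) //= [RHS](bigD1 [set setT]) //= !big_set1 subargsT.
set S1 := \sum_(_ | _) _; set S2 := \sum_(_ | _) _.
suff -> : S1 = S2 by apply: addIr.
apply: eq_bigr => P /andP[Pnc PT]; apply: eq_bigr => V VP.
have ltV := cumulant_block_small Pnc PT VP.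
apply: IHk; rewrite size_subargs; first by rewrite -ltnS (leq_trans ltV).
rewrite card_gt0; apply: contraTneq VP => ->.
by case/andP: Pnc => /and3P[].
Qed.

(* Free independence of a family x of random variables: phi vanishes on     *)
(* alternating products of centred elements of the unital subalgebras       *)
(* generated by the x i. The elements of the subalgebra generated by x i    *)
(* are the values at x i of the polynomials over F.                         *)
Definition freely_independent (I : eqType) (x : I -> A) : Prop :=
  forall s : seq (I * {poly F}),
    s != [::] ->
    sorted (fun u v => u.1 != v.1) s ->
    (forall u, u \in s -> phi (horner_alg (x u.1) u.2) = 0) ->
    phi (\prod_(u <- s) horner_alg (x u.1) u.2) = 0.

Definition free_pair (a b : A) : Prop :=
  freely_independent (fun i : bool => if i then a else b).

Definition free_poisson (lambda : F) (a : A) : Prop :=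
  forall n, (0 < n)%N -> free_cumulant (nseq n a) = lambda.

Definition moment_series (x : A) : fps F :=
  Fps (fun n => if n is 0 then 0 else phi (x ^+ n)).

End FreeProbability.

(* Main.v *)
From HB Require Import structures.
Require Import Defs.
From mathcomp Require Import all_boot all_order all_algebra.
From mathcomp Require Import reals complex.
From mathcomp Require Import ring zify.

(** Write [w = a b + b a].  The idea is to find enough quadratic relations
    between the series [sum_n phi (u w^n v) z^n], for short words [u] and [v]
    in [a] and [b], to determine them all.

    The relations are instances of the loop (Schwinger-Dyson) equation of a
    free Poisson element: for every noncommutative polynomial [Q] in [a], [b],
<<
      phi (a Q) = phi Q + sum phi Q1 * phi (a Q2),
>>
    the sum being over all the ways to single out a letter [a] of [Q], as
    [Q = Q1 a Q2] ([loop_equation]).  When [Q] is a power of [a] this is the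
    Catalan recursion for the moments of [a], that is, for the number of
    noncrossing partitions ([noncrossing_countS]).  In general the difference
    of both sides is multilinear in the factors of [Q], and freeness makes it
    vanish when these factors are centred and alternate between polynomials in
    [a] and in [b]; that is enough, because every product is a linear
    combination of such alternating centred products
    ([free_multilinear_eq0]).  The same principle shows that moments do not
    change when words are reversed, or when [a] and [b] are exchanged.

    Choosing [Q = u w^n v], the loop equation expresses the series of
    [(a u, v)] by products of series of the same kind
    ([resolvent_series_loop]).  With [u] in [{1, b}] and [v] in [{1, a, b}],
    the system closes up on seven series.  Eliminating five of them leaves the
    moment series [m] and [P = z sum_n phi (a w^n) z^n], related by
<<
      m (1 - 2 P) (1 + P) = 2 P (1 + 2 P),
      z (m + 1) (m + 2) = 2 P (1 - P).
>>
    The first relation turns [(m + 2) (9 m + 2)] into the square of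
    [(1 + 4 P) (m + 2)], after which the second one says that substituting [m]
    into the announced series gives [z]
    ([anticommutator_identities]).  As [m] has a nonzero linear coefficient,
    a left inverse is also a right inverse
    ([fps_comp_inverse_right]). *)

Set Implicit Arguments.
Unset Strict Implicit.
Unset Printing Implicit Defensive.

Import GRing.Theory.
Local Open Scope ring_scope.

(** * Noncrossing partitions are counted by the Catalan numbers *)

Section NoncrossingCount.
Local Open Scope nat_scope.

(** These are the words obtained from a noncrossing partition by labelling
    each point with the least point of its block: if [w_k <= j <= k], the block of [j] is nested below an arc
    of the block of [k], or is that block, so its least point is at least
    [w_k].  Taking [j = w_k] shows that [w_k] labels itself. *)
Definition bracket_word (w : seq nat) : Prop :=
  forall k, k < size w -> nth 0 w k <= k /\
    forall j, nth 0 w k <= j <= k -> nth 0 w k <= nth 0 w j.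

Section BlockMinima.
Variable n : nat.
Implicit Types (P : {set {set 'I_n}}) (i j : 'I_n).

Definition block_min P i : 'I_n := [arg min_(j < i | j \in pblock P i) j].
Definition min_word P : seq nat := [seq val (block_min P i) | i <- enum 'I_n].

Lemma size_min_word P : size (min_word P) = n.
Proof. by rewrite size_map size_enum_ord. Qed.

Lemma nth_min_word P i : nth 0 (min_word P) i = block_min P i.
Proof.
by rewrite (nth_map i) ?size_enum_ord // nth_ord_enum.
Qed.

Section Partition.
Variables (P : {set {set 'I_n}}) (Ppart : partition P [set: 'I_n]).

Let tiP : trivIset P. Proof. by case/and3P: Ppart. Qed.

Lemma in_cover i : i \in cover P.
Proof. by case/and3P: Ppart => /eqP-> _ _; rewrite inE. Qed.

Lemma block_min_mem i : block_min P i \in pblock P i.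
Proof.
by rewrite /block_min; case: arg_minnP; rewrite ?mem_pblock ?in_cover.
Qed.

Lemma block_min_le i j : j \in pblock P i -> block_min P i <= j.
Proof.
rewrite /block_min; case: arg_minnP => [|k _ kmin]; last exact: kmin.
by rewrite mem_pblock in_cover.
Qed.

Lemma eq_block_min i j :
  (j \in pblock P i) = (block_min P i == block_min P j).
Proof.
apply/idP/eqP => [ij | E].
  have Eb := same_pblock tiP ij.
  apply/val_inj/eqP; rewrite eqn_leq !block_min_le //.
    by rewrite Eb; exact: block_min_mem.
  by rewrite -Eb; exact: block_min_mem.
have := block_min_mem j; rewrite -E => /(same_pblock tiP) E'.
have := block_min_mem i => /(same_pblock tiP) <-; rewrite E'.
by rewrite mem_pblock in_cover.
Qed.

End Partition.

(** If [m] is the least point of the block of [k], and the block of [j] starts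
    at [i] with [i < m < j < k], then [i, m, j, k] is a crossing. *)
Lemma noncrossing_bracket_word P : noncrossing P -> bracket_word (min_word P).
Proof.
move=> /andP[Ppart ncP] k; rewrite size_min_word => ltkn.
set k' := Ordinal ltkn; have -> : k = k' by [].
rewrite nth_min_word; have le_mk : block_min P k' <= k'.
  by apply: block_min_le; rewrite // mem_pblock in_cover.
split=> // j /andP[mj jk]; have ltjn := leq_ltn_trans jk ltkn.
set j' := Ordinal ltjn in mj jk *; have Ej : j = j' by [].
rewrite Ej in mj jk *; rewrite nth_min_word leqNgt; apply/negP => lt_m.
have tiP : trivIset P by case/and3P: Ppart.
have Pb i : pblock P i \in P by rewrite pblock_mem ?in_cover.
have ne_m : block_min P j' != block_min P k' :> nat by rewrite ltn_eqF.
have mj' : block_min P k' < j'.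
  rewrite ltn_neqAle mj andbT; apply: contraNneq ne_m => E.
  have := block_min_mem Ppart k'; rewrite (val_inj E : block_min P k' = j').
  rewrite eq_block_min // => /eqP <-.
  by rewrite (val_inj E : block_min P k' = j').
have jk' : j' < k'.
  rewrite ltn_neqAle jk andbT; apply: contraNneq ne_m => E.
  by rewrite (val_inj E : j' = k').
move/forall_inP: ncP => /(_ _ (Pb j'))/forall_inP/(_ _ (Pb k')).
move=> /forall_inP/(_ _ (block_min_mem Ppart j')).
move=> /forall_inP/(_ _ (block_min_mem Ppart k')).
have self i : i \in pblock P i by rewrite mem_pblock in_cover.
move=> /forall_inP/(_ _ (self j'))/forall_inP/(_ _ (self k')).
rewrite lt_m mj' jk' /= (eq_pblock _ tiP) ?in_cover //.
by rewrite eq_block_min // => /eqP E; rewrite E eqxx in ne_m.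
Qed.

Lemma min_word_inj :
  {in [pred P | partition P [set: 'I_n]] &, injective min_word}.
Proof.
move=> P Q; rewrite !inE => partP partQ E.
rewrite -(equivalence_partition_pblock partP).
rewrite -(equivalence_partition_pblock partQ).
have Em i : block_min P i = block_min Q i.
  by apply: val_inj; rewrite /= -!nth_min_word E.
rewrite /equivalence_partition; apply: eq_in_imset => i _.
by apply/setP=> j; rewrite !inE !eq_block_min // !Em.
Qed.

(** The partition is the kernel of [i |-> w_i].  For a crossing
    [i < j < k < l], the bracket condition at [k] gives [w_i <= w_j], and at
    [l] gives [w_j <= w_i]. *)
Lemma bracket_word_surj w : size w = n -> bracket_word w ->
  exists2 P, noncrossing P & min_word P = w.
Proof.
move=> sz_w bw; pose f (i : 'I_n) := nth 0 w i.
pose P := preim_partition f [set: 'I_n].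
have partP : partition P setT by exact: preim_partitionP.
have inb i j : (j \in pblock P i) = (f i == f j).
  rewrite pblock_equivalence_partition ?inE //.
  by move=> x y z _ _ _; split=> // /eqP->.
have f_le i : f i <= i by case: (bw i); rewrite ?sz_w.
have f_le2 i j : f i <= j <= i -> f i <= f j.
  by case: (bw i); rewrite ?sz_w // => _ /(_ j).
have tiP : trivIset P by case/and3P: partP.
exists P.
  rewrite /noncrossing partP.
  apply/forall_inP => V VP; apply/forall_inP => W WP.
  apply/forall_inP => i iV; apply/forall_inP => j jW.
  apply/forall_inP => k kV; apply/forall_inP => l lW.
  apply/implyP => /and3P[ij jk kl].
  have Eik : f i = f k.
    by apply/eqP; rewrite -inb (def_pblock tiP VP iV).
  have Ejl : f j = f l.
    by apply/eqP; rewrite -inb (def_pblock tiP WP jW).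
  have Eij : f i = f j.
    apply/eqP; rewrite eqn_leq; apply/andP; split.
      by rewrite Eik; apply: f_le2; have := f_le i; lia.
    rewrite Ejl Eik; apply: f_le2; have := f_le j; lia.
  rewrite -(def_pblock tiP VP iV) -(def_pblock tiP WP jW) eq_pblock ?in_cover //.
  by rewrite inb Eij.
apply: (@eq_from_nth _ 0); rewrite size_min_word ?sz_w // => i ltin.
have -> : i = Ordinal ltin by [].
rewrite nth_min_word; set i' := Ordinal ltin; rewrite -/(f i').
have lt_f : f i' < n by exact: leq_ltn_trans (f_le i') ltin.
have ff : f (Ordinal lt_f) = f i'.
  by apply/eqP; rewrite eqn_leq f_le f_le2 //= leqnn f_le.
apply/eqP; rewrite eqn_leq; apply/andP; split.
  have := @block_min_le P partP i' (Ordinal lt_f); apply.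
  by rewrite inb ff.
have := block_min_mem partP i'; rewrite inb => /eqP ->; exact: f_le.
Qed.

Definition bracket_words : seq (seq nat) :=
  [seq min_word P | P <- enum [pred P | noncrossing P]].

Lemma bracket_words_uniq : uniq bracket_words.
Proof.
rewrite map_inj_in_uniq ?enum_uniq // => P Q.
rewrite !mem_enum !inE => /andP[partP _] /andP[partQ _].
by apply: min_word_inj; rewrite inE.
Qed.

Lemma mem_bracket_words w :
  w \in bracket_words <-> size w = n /\ bracket_word w.
Proof.
split=> [/mapP[P] | [sz_w /bracket_word_surj[]// P ncP <-]].
  rewrite mem_enum inE => /noncrossing_bracket_word bP ->.
  by rewrite size_min_word.
by rewrite map_f // mem_enum inE.
Qed.

End BlockMinima.

Definition noncrossing_count n := #|[pred P : {set {set 'I_n}} | noncrossing P]|.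

Lemma size_bracket_words n : size (bracket_words n) = noncrossing_count n.
Proof. by rewrite size_map -cardE. Qed.

(** The letter [0] in the middle is that of the largest point [p] of the block
    of the point [0].  Points after [p] have their labels after [p] as well,
    since another block with points on both sides of [p] would cross it. *)
Definition glue (p : nat) (uv : seq nat * seq nat) : seq nat :=
  uv.1 ++ 0 :: map (addn p.+1) uv.2.

Lemma glue_bracket_word u v :
  bracket_word u -> bracket_word v -> bracket_word (glue (size u) (u, v)).
Proof.
move=> bu bv k; rewrite size_cat /= size_map => ltk.
rewrite /glue /= !nth_cat.
have [ltku|] := ltnP k (size u).
  have [le_k mono] := bu k ltku; split=> // j /andP[kj jk].
  by rewrite nth_cat (leq_ltn_trans jk ltku) mono ?kj.
rewrite leq_eqVlt => /predU1P[<-|ltuk]; first by rewrite subnn.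
have -> /= : k - size u = (k - (size u).+1).+1 by lia.
have ltkv : k - (size u).+1 < size v by lia.
rewrite (nth_map 0) //; have [le_k mono] := bv _ ltkv.
split=> [|j /andP[kj jk]]; first lia.
rewrite nth_cat; have -> : (j < size u) = false by lia.
have -> /= : j - size u = (j - (size u).+1).+1 by lia.
rewrite (nth_map 0); last lia.
by rewrite leq_add2l mono //; lia.
Qed.

(** The cut is at the last letter [0]. *)
Lemma bracket_word_glue w n : size w = n.+1 -> bracket_word w ->
  exists u v, [/\ bracket_word u, bracket_word v, (size u + size v)%N = n
                & w = glue (size u) (u, v)].
Proof.
move=> sz_w bw.
have ex0 : exists k, (k < size w) && (nth 0 w k == 0).
  by exists 0; rewrite sz_w -leqn0; case: (bw 0); rewrite ?sz_w.
have [|p /andP[ltp /eqP wp] pmax] := ex_maxnP ex0 (m := n).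
  by move=> k; rewrite sz_w => /andP[].
have lt_p k : p < k < size w -> p < nth 0 w k.
  move=> /andP[pk kw]; rewrite ltnNge; apply/negP => lekp.
  have [_ /(_ p)] := bw k kw; rewrite lekp (ltnW pk) wp leqn0 => /(_ isT) wk0.
  by have := pmax k; rewrite kw wk0 leqNgt pk => /(_ isT).
pose v := map (subn^~ p.+1) (drop p.+1 w).
have sz_v : size v = n - p by rewrite size_map size_drop sz_w subSS.
have sz_u : size (take p w) = p by rewrite size_takel // ltnW.
have nth_v k : k < size v -> nth 0 v k = nth 0 w (p.+1 + k) - p.+1.
  rewrite sz_v => ltk; rewrite (nth_map 0) ?nth_drop //.
  by rewrite size_drop sz_w subSS.
exists (take p w), v; rewrite sz_u; split.
- move=> k; rewrite sz_u => ltkp; have [le_k mono] := bw k (ltn_trans ltkp ltp).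
  rewrite nth_take //; split=> // j jk; rewrite nth_take ?mono //; lia.
- move=> k ltk; have ltk' : p.+1 + k < size w by lia.
  have [le_k mono] := bw _ ltk'; rewrite nth_v //; split=> [|j jk]; first lia.
  rewrite nth_v; last lia.
  apply: leq_sub2r; apply: mono.
  by have := lt_p _ (_ : p < p.+1 + k < size w); lia.
- by rewrite sz_v; lia.
- rewrite /glue /= -[LHS](cat_take_drop p); congr (_ ++ _).
  rewrite (drop_nth 0) // wp; congr (_ :: _); rewrite /v -map_comp.
  rewrite -[LHS]map_id; apply/eq_in_map => x /(nthP 0)[k].
  rewrite size_drop => ltk; rewrite nth_drop => <- /=.
  rewrite subnKC //; apply: lt_p.
  by rewrite addSn ltnS leq_addr -addSn -ltn_subRL.
Qed.

(** The position of the last [0] is read off the reversed word. *)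
Lemma glue_size_inj u v u' v' :
  glue (size u) (u, v) = glue (size u') (u', v') -> size u = size u'.
Proof.
move=> E; have : index 0 (rev (glue (size u) (u, v))) =
                 index 0 (rev (glue (size u') (u', v'))) by rewrite E.
have := congr1 size E; rewrite !size_cat /= !size_map.
have notin p s : 0 \notin rev (map (addn p.+1) s).
  by rewrite mem_rev; apply/mapP => -[].
rewrite /glue /= !rev_cat !rev_cons !cat_rcons !index_cat !(negPf (notin _ _)) /=.
rewrite !size_rev !size_map; lia.
Qed.

Lemma noncrossing_count0 : noncrossing_count 0 = 1.
Proof.
rewrite -size_bracket_words; apply: (@perm_size _ _ [:: [::]]).
apply: uniq_perm; rewrite ?bracket_words_uniq // => w; rewrite inE.
apply/idP/eqP => [/mem_bracket_words[/size0nil] | ->] //.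
exact/mem_bracket_words.
Qed.

Lemma noncrossing_countS n : noncrossing_count n.+1 =
  \sum_(p < n.+1) noncrossing_count p * noncrossing_count (n - p).
Proof.
pose L := [seq glue p uv | p <- iota 0 n.+1,
   uv <- [seq (u, v) | u <- bracket_words p, v <- bracket_words (n - p)]].
have -> : noncrossing_count n.+1 = size L.
  rewrite -size_bracket_words; apply: perm_size.
  apply: uniq_perm; rewrite ?bracket_words_uniq //.
    apply: allpairs_uniq_dep; rewrite ?iota_uniq //.
      move=> p _; apply: allpairs_uniq; rewrite ?bracket_words_uniq //.
      by move=> [u v] [u' v'].
    move=> x y /allpairsPdep[p [_ [_ /allpairsP[[u v] [up _ ->]] ->]]].
    move=> /allpairsPdep[p' [_ [_ /allpairsP[[u' v'] [up' _ ->]] ->]]] /=.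
    move/mem_bracket_words: up => [<- _]; move/mem_bracket_words: up' => [<- _].
    move=> E; have Es := glue_size_inj E; move: E; rewrite /glue /= Es.
    move=> /eqP; rewrite eqseq_cat // => /andP[/eqP-> /=].
    by rewrite eqseq_cons => /andP[_ /eqP/(inj_map (@addnI _))->].
  move=> w; apply/idP/allpairsPdep => [/mem_bracket_words[sz_w bw]|].
    have [u [v [bu bv sz ->]]] := bracket_word_glue sz_w bw.
    exists (size u), (u, v); split=> //; first by rewrite mem_iota; lia.
    apply/allpairsP; exists (u, v); split=> //; apply/mem_bracket_words => //.
    by split=> //=; lia.
  case=> p [_ [+ /allpairsP[[u v] /= [up vp ->]] ->]]; rewrite mem_iota => ltp.
  move/mem_bracket_words: up => [up bu]; move/mem_bracket_words: vp => [vp bv].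
  apply/mem_bracket_words; rewrite -up; split; last exact: glue_bracket_word.
  by rewrite size_cat /= size_map up vp addnS subnKC.
rewrite size_allpairs_dep sumnE big_map -(big_mkord xpredT
  (fun p => noncrossing_count p * noncrossing_count (n - p))).
rewrite /index_iota subn0; apply: eq_bigr => p _.
by rewrite size_allpairs !size_bracket_words.
Qed.

End NoncrossingCount.

Section FreePoissonMoments.
Variables (F : fieldType) (A : algType F) (phi : {scalar A}) (a : A).
Hypotheses (phi1 : phi 1 = 1) (ha : free_poisson phi 1 a).

Lemma free_poisson_moment n : phi (a ^+ n) = (noncrossing_count n)%:R.
Proof.
case: n => [|n]; first by rewrite expr0 phi1 noncrossing_count0.
have := @moment_cumulant _ _ phi (nseq n.+1 a) isT.
have -> : \prod_(x <- nseq n.+1 a) x = a ^+ n.+1.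
  elim: n.+1 => [|m IHm]; rewrite ?big_nil // big_cons exprS; congr (_ * _).
  exact: IHm.
move=> ->; rewrite -[in RHS](size_nseq n.+1 a) /noncrossing_count -sum1_card.
rewrite natr_sum; apply: eq_bigr => P ncP; apply: big1 => V VP.
have /all_pred1P -> : all (pred1 a) (subargs V).
  apply/allP => _ /mapP[i _ ->] /=; have := mem_nth 0 (ltn_ord i).
  by rewrite mem_nseq => /andP[].
apply: ha; rewrite size_subargs card_gt0; apply: contraTneq VP => ->.
by case/andP: ncP => /and3P[].
Qed.

Lemma free_poisson_momentS n :
  phi (a ^+ n.+1) = \sum_(i < n.+1) phi (a ^+ i) * phi (a ^+ (n - i)).
Proof.
rewrite free_poisson_moment noncrossing_countS natr_sum.
by apply: eq_bigr => i _; rewrite natrM !free_poisson_moment.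
Qed.

End FreePoissonMoments.

(** * Linear functionals on products of free elements *)

Section PolyFunctionals.
Variable F : fieldType.

(** Linear forms are handled as plain functions, since they arise here by
    letting one factor vary inside a larger expression. *)
Definition scalar_map (V : lmodType F) (f : V -> F) : Prop :=
  forall c p q, f (c *: p + q) = c * f p + f q.

Lemma scalar_map_sum (V : lmodType F) (f : V -> F) (I : Type) (r : seq I)
    (E : I -> V) :
  scalar_map f -> f (\sum_(i <- r) E i) = \sum_(i <- r) f (E i).
Proof.
move=> fl; have f0 : f 0 = 0.
  by apply: (addIr (f 0)); have := fl 1 0 0; rewrite scaler0 addr0 mul1r add0r.
elim: r => [|i r IHr]; rewrite ?big_nil // !big_cons -IHr.
by have := fl 1 (E i); rewrite scale1r mul1r.
Qed.

Lemma scalar_mapZ (V : lmodType F) (f : V -> F) c p :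
  scalar_map f -> f (c *: p) = c * f p.
Proof.
move=> fl; rewrite -[c *: p]addr0 fl -[X in _ = X]addr0; congr (_ + _).
by have := scalar_map_sum [::] (fun _ : nat => 0) fl; rewrite !big_nil.
Qed.

Lemma eq_poly_functional (f g : {poly F} -> F) :
    scalar_map f -> scalar_map g -> (forall n, f 'X^n = g 'X^n) -> f =1 g.
Proof.
move=> fl gl fg p; rewrite -[p]coefK poly_def !scalar_map_sum //.
by apply: eq_bigr => i _; rewrite !scalar_mapZ // fg.
Qed.

Definition poly_functional (h : nat -> F) (p : {poly F}) : F :=
  \sum_(n < size p) p`_n * h n.

Lemma poly_functional_wide h (p : {poly F}) N : (size p <= N)%N ->
  poly_functional h p = \sum_(n < N) p`_n * h n.
Proof.
move=> leN; rewrite /poly_functional (big_ord_widen N (fun n => p`_n * h n)) //.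
rewrite big_mkcond; apply: eq_bigr => n _.
by case: ltnP => // len; rewrite nth_default ?mul0r.
Qed.

Lemma poly_functional_scalar h : scalar_map (poly_functional h).
Proof.
move=> c p q; pose N := maxn (size (c *: p + q)) (maxn (size p) (size q)).
rewrite !(@poly_functional_wide _ _ N) /N ?leq_max ?leqnn ?orbT //.
rewrite mulr_sumr -big_split; apply: eq_bigr => n _ /=.
by rewrite coefD coefZ mulrDl mulrA.
Qed.

Lemma poly_functionalXn h n : poly_functional h 'X^n = h n.
Proof.
rewrite /poly_functional size_polyXn big_ord_recr big1 /= => [|i _].
  by rewrite coefXn eqxx mul1r add0r.
by rewrite coefXn ltn_eqF ?mul0r.
Qed.

End PolyFunctionals.

Section FreeFamily.
Variables (F : fieldType) (A : algType F) (phi : {scalar A}).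
Hypothesis phi1 : phi 1 = 1.
Implicit Types (u v w : A) (p q : {poly F}).

Local Notation letter := (bool * {poly F})%type.
Implicit Types (s t : seq letter) (x : bool -> A).

(** A list of letters stands for a product of polynomials in single variables,
    kept unevaluated: operations on the factors, such as reversal or the
    extraction of a letter, need not be well defined on elements of [A]. *)
Definition peval x s : A := \prod_(l <- s) horner_alg (x l.1) l.2.

Lemma peval_nil x : peval x [::] = 1.
Proof. exact: big_nil. Qed.

Lemma peval_cons x i p s :
  peval x ((i, p) :: s) = horner_alg (x i) p * peval x s.
Proof. exact: big_cons. Qed.

Lemma peval_cat x s t : peval x (s ++ t) = peval x s * peval x t.
Proof. exact: big_cat. Qed.

Lemma peval_rcons x s i p :
  peval x (rcons s (i, p)) = peval x s * horner_alg (x i) p.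
Proof. by rewrite -cats1 peval_cat peval_cons peval_nil mulr1. Qed.

Definition alternating s := sorted (fun i j => i != j) [seq l.1 | l <- s].
Definition centred x s :=
  forall l, l \in s -> phi (horner_alg (x l.1) l.2) = 0.

Lemma centred_cons x i p s : phi (horner_alg (x i) p) = 0 -> centred x s ->
  centred x ((i, p) :: s).
Proof. by move=> p0 s0 l; rewrite inE => /predU1P[->//|/s0]. Qed.

Lemma centred_cat x s t : centred x (s ++ t) <-> centred x s /\ centred x t.
Proof.
split=> [st | [s0 t0] l]; last by rewrite mem_cat => /orP[/s0|/t0].
by split=> l ls; apply: st; rewrite mem_cat ls ?orbT.
Qed.

Definition center x i p : {poly F} := p - (phi (horner_alg (x i) p))%:P.

Lemma phi_center x i p : phi (horner_alg (x i) (center x i p)) = 0.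
Proof.
by rewrite rmorphB /= horner_algC linearB linearZ /= phi1 mulr1 subrr.
Qed.

Lemma centerK x i p : p = phi (horner_alg (x i) p) *: 1 + center x i p.
Proof. by rewrite alg_polyC addrC subrK. Qed.

Lemma not_alternating s : ~~ alternating s ->
  exists s1 i p q s2, s = s1 ++ [:: (i, p), (i, q) & s2].
Proof.
elim: s => [|[i p] [|[j q] s] IHs] //.
rewrite /alternating /= negb_and negbK => /orP[/eqP->|].
  by exists [::], j, p, q, s.
by move=> /IHs[s1 [k [p' [q' [s2 ->]]]]]; exists ((i, p) :: s1), k, p', q', s2.
Qed.

(** Induction on the number of factors.  Adjacent factors in the same variable
    are merged; in an alternating product, each factor in turn is replaced by
    its centred part, and the constant that splits off drops a factor. *)
Lemma free_multilinear_eq0 x (Phi : seq letter -> F) :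
    Phi [::] = 0 ->
    (forall s i t, scalar_map (fun p => Phi (s ++ (i, p) :: t))) ->
    (forall s i t, Phi (s ++ (i, 1) :: t) = Phi (s ++ t)) ->
    (forall s i p q t,
       Phi (s ++ [:: (i, p), (i, q) & t]) = Phi (s ++ (i, p * q) :: t)) ->
    (forall s, s != [::] -> alternating s -> centred x s -> Phi s = 0) ->
  forall s, Phi s = 0.
Proof.
move=> Phi0 Phi_lin Phi_1 Phi_M Phi_alt s.
have [n] := ubnP (size s); elim: n s => // n IHn s; rewrite ltnS => les.
have [alt_s|] := boolP (alternating s); last first.
  move=> /not_alternating[s1 [i [p [q [s2 Es]]]]]; rewrite Es Phi_M IHn //.
  by apply: leq_trans les; rewrite Es !size_cat /= !addnS.
(* The letters of s1 are centred already, those of s2 remain to be treated. *)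
suff cent s1 s2 : (size (s1 ++ s2) <= n)%N -> alternating (s1 ++ s2) ->
    centred x s1 -> Phi (s1 ++ s2) = 0.
  exact: (cent [::]).
elim: s2 s1 => [|[i p] s2 IHs2] s1.
  rewrite cats0; case: s1 => // l s1 _; exact: Phi_alt.
move=> le12 alt12 c1; rewrite (centerK x i p) Phi_lin Phi_1.
rewrite IHn ?mulr0 ?add0r; last first.
  by apply: leq_trans le12; rewrite !size_cat /= addnS.
rewrite -cat_rcons; apply: IHs2.
- by rewrite cat_rcons; move: le12; rewrite !size_cat.
- by move: alt12; rewrite /alternating !map_cat /= map_rcons cat_rcons.
- rewrite -cats1; apply/centred_cat; split=> //.
  by apply: centred_cons; rewrite ?phi_center.
Qed.

Lemma horner_alg_comb (y : A) c p q :
  horner_alg y (c *: p + q) = c *: horner_alg y p + horner_alg y q.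
Proof. by rewrite linearP /= mulr_algl. Qed.

Lemma phi_peval_scalar x u s i t v :
  scalar_map (fun p => phi (u * peval x (s ++ (i, p) :: t) * v)).
Proof.
move=> c p q; rewrite !peval_cat !peval_cons horner_alg_comb !(mulrDl, mulrDr).
by rewrite -!(scalerAl, scalerAr) linearP.
Qed.

Section Free.
Variable x : bool -> A.
Hypothesis free_x : freely_independent phi x.

Lemma free_alternating s :
  s != [::] -> alternating s -> centred x s -> phi (peval x s) = 0.
Proof. by move=> s0; rewrite /alternating sorted_map; exact: free_x. Qed.

Lemma free_alternating_rcons s i p : s != [::] ->
  alternating (rcons s (i, p)) -> centred x s ->
  phi (peval x s * horner_alg (x i) p) = 0.
Proof.
move=> s0 alt_s cs; rewrite [p](centerK x i) horner_alg_comb rmorph1 mulrDr linearD.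
rewrite -scalerAr mulr1 linearZ /= free_alternating //; last first.
  by move: alt_s; rewrite /alternating map_rcons -cats1 => /cat_sorted2[].
rewrite mulr0 add0r -peval_rcons free_alternating //.
- by case: s {s0 alt_s cs}.
- by move: alt_s; rewrite /alternating !map_rcons.
- rewrite -cats1; apply/centred_cat; split=> //.
  by apply: centred_cons; rewrite ?phi_center.
Qed.

Lemma free_alternating_cons s i p : s != [::] ->
  alternating ((i, p) :: s) -> centred x s ->
  phi (horner_alg (x i) p * peval x s) = 0.
Proof.
move=> s0 alt_s cs; rewrite [p](centerK x i) horner_alg_comb rmorph1 mulrDl linearD.
rewrite -scalerAl mul1r linearZ /= free_alternating //; last first.
  by move: alt_s; rewrite /alternating /= => /path_sorted.
rewrite mulr0 add0r -peval_cons free_alternating //.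
by apply: centred_cons; rewrite ?phi_center.
Qed.

(** Reversal keeps products alternating and centred, and the polynomials in a
    single variable commute, so that merging is compatible with it. *)
Lemma free_moment_rev s : phi (peval x (rev s)) = phi (peval x s).
Proof.
apply/eqP; rewrite -subr_eq0; apply/eqP; move: s.
apply: (@free_multilinear_eq0 x (fun s => phi (peval x (rev s)) - phi (peval x s))).
- by rewrite subrr.
- move=> s i t c p q; rewrite !rev_cat !rev_cons !cat_rcons.
  have := @phi_peval_scalar x 1 (rev t) i (rev s) 1 c p q.
  have := @phi_peval_scalar x 1 s i t 1 c p q.
  by rewrite !mul1r !mulr1 => -> ->; ring.
- move=> s i t; rewrite !rev_cat rev_cons cat_rcons !peval_cat !peval_cons.
  by rewrite !rmorph1 !mul1r.
- move=> s i p q t; rewrite !rev_cat !rev_cons !cat_rcons !peval_cat !peval_cons.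
  congr (phi _ - phi _); last by rewrite rmorphM /= !mulrA.
  by rewrite [p * q]mulrC rmorphM /= !mulrA.
- move=> s s0 alt_s cs; rewrite !free_alternating ?subrr //.
  + by rewrite -size_eq0 size_rev size_eq0.
  + rewrite /alternating map_rev rev_sorted; apply: sub_sorted alt_s => i j.
    by rewrite eq_sym.
  + by move=> l; rewrite mem_rev; exact: cs.
Qed.

End Free.

Lemma free_moment_eq x y : freely_independent phi x -> freely_independent phi y ->
    (forall i n, phi (x i ^+ n) = phi (y i ^+ n)) ->
  forall s, phi (peval x s) = phi (peval y s).
Proof.
move=> free_x free_y xy s; apply/eqP; rewrite -subr_eq0; apply/eqP; move: s.
apply: (@free_multilinear_eq0 x (fun s => phi (peval x s) - phi (peval y s))).
- by rewrite !peval_nil subrr.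
- move=> s i t c p q.
  have := @phi_peval_scalar x 1 s i t 1 c p q.
  have := @phi_peval_scalar y 1 s i t 1 c p q.
  by rewrite !mul1r !mulr1 => -> ->; ring.
- by move=> s i t; rewrite !peval_cat !peval_cons !rmorph1 !mul1r.
- by move=> s i p q t; rewrite !peval_cat !peval_cons !rmorphM /= !mulrA.
- move=> s s0 alt_s cs; rewrite !free_alternating ?subrr // => l /cs <-.
  have horner_scalar z : scalar_map (fun p => phi (horner_alg z p)).
    by move=> c p q; rewrite horner_alg_comb linearP.
  apply: (eq_poly_functional (horner_scalar _) (horner_scalar _)) => n.
  by rewrite !rmorphXn /= !horner_algX xy.
Qed.

Lemma freely_independent_swap x : freely_independent phi x ->
  freely_independent phi (x \o negb).
Proof.
move=> free_x s s0 alt_s cs.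
pose t : seq letter := [seq (~~ l.1, l.2) | l <- s].
have -> : \prod_(l <- s) horner_alg ((x \o negb) l.1) l.2
        = \prod_(l <- t) horner_alg (x l.1) l.2 by rewrite big_map.
apply: free_x; first by rewrite -size_eq0 size_map size_eq0.
  rewrite sorted_map; apply: sub_sorted alt_s => l m /=.
  by rewrite (inj_eq negb_inj).
by move=> _ /mapP[l ls ->]; exact: cs.
Qed.

End FreeFamily.

(** * The loop equation of a free Poisson element *)

Section Loop.
Variables (F : fieldType) (A : algType F) (phi : {scalar A}).
Hypothesis phi1 : phi 1 = 1.
Variable x : bool -> A.
Hypothesis free_x : freely_independent phi x.
Hypothesis momentS : forall n,
  phi (x true ^+ n.+1)
  = \sum_(i < n.+1) phi (x true ^+ i) * phi (x true ^+ (n - i)).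
Local Notation a := (x true).
Local Notation letter := (bool * {poly F})%type.
Local Notation peval := (peval x).
Local Notation ev i p := (horner_alg (x i) p).
Implicit Types (u v w : A) (p q : {poly F}) (s t : seq letter).

(** The form [phi (u _) (x) phi (a _ v)] applied to the difference quotient
    [(p (X) - p (Y)) / (X - Y)], which maps ['X^n] to the sum of the
    [X^i Y^(n - 1 - i)].  The letter [a] that is singled out is absorbed in the
    second exponent. *)
Definition quotient_functional u p v : F :=
  poly_functional
    (fun n => \sum_(i < n) phi (u * a ^+ i) * phi (a ^+ (n - i) * v)) p.

(** The sum of [phi (u Q1) * phi (a Q2 v)] over the occurrences
    [Q = Q1 a Q2] of [a] in the product [Q] encoded by [s]; this is the free
    difference quotient with respect to [a], extended as a derivation. *)
Fixpoint loop_functional u s v : F :=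
  if s is (i, p) :: s' then
    (if i then quotient_functional u p (peval s' * v) else 0)
    + loop_functional (u * ev i p) s' v
  else 0.

Lemma quotient_scalar_left p v : scalar_map (fun u => quotient_functional u p v).
Proof.
move=> c u w; rewrite /quotient_functional /poly_functional mulr_sumr -big_split /=.
apply: eq_bigr => n _; rewrite mulrCA -mulrDr; congr (_ * _).
rewrite mulr_sumr -big_split; apply: eq_bigr => i _ /=.
by rewrite mulrDl -scalerAl linearP mulrDl mulrA.
Qed.

Lemma quotient_scalar_right u p : scalar_map (quotient_functional u p).
Proof.
move=> c v w; rewrite /quotient_functional /poly_functional mulr_sumr -big_split /=.
apply: eq_bigr => n _; rewrite mulrCA -mulrDr; congr (_ * _).
rewrite mulr_sumr -big_split; apply: eq_bigr => i _ /=.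
by rewrite mulrDr -scalerAr linearP mulrDr mulrCA.
Qed.

Lemma quotient_scalar u v : scalar_map (fun p => quotient_functional u p v).
Proof. exact: poly_functional_scalar. Qed.

(** The Leibniz rule of the difference quotient, checked on monomials. *)
Lemma quotient_functionalM u p q v : quotient_functional u (p * q) v =
  quotient_functional u p (ev true q * v) + quotient_functional (u * ev true p) q v.
Proof.
pose rhs p q := quotient_functional u p (ev true q * v)
                + quotient_functional (u * ev true p) q v.
rewrite -/(rhs p q).
apply: (eq_poly_functional (f := fun p => quotient_functional u (p * q) v)
                           (g := rhs^~ q)) => [c r r'|c r r'|m].
- by rewrite mulrDl -scalerAl quotient_scalar.
- rewrite /rhs quotient_scalar horner_alg_comb mulrDr -scalerAr.
  by rewrite quotient_scalar_left; ring.
apply: (eq_poly_functional (f := fun q => quotient_functional u ('X^m * q) v)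
                           (g := rhs 'X^m)) => [c r r'|c r r'|n].
- by rewrite mulrDr -scalerAr quotient_scalar.
- rewrite /rhs quotient_scalar horner_alg_comb mulrDl -scalerAl.
  by rewrite quotient_scalar_right; ring.
rewrite /rhs -exprD /quotient_functional !poly_functionalXn big_split_ord /=.
rewrite !rmorphXn /= !horner_algX; congr (_ + _); apply: eq_bigr => i _.
  by rewrite mulrA -exprD addnBAC // ltnW.
by rewrite -mulrA -exprD subnDl.
Qed.

Lemma quotient_functional1 u v : quotient_functional u 1 v = 0.
Proof. by rewrite /quotient_functional -(expr0 'X) poly_functionalXn big_ord0. Qed.

Lemma quotient_functionalX u v : quotient_functional u 'X v = phi u * phi (a * v).
Proof.
by rewrite /quotient_functional -(expr1 'X) poly_functionalXn big_ord1 mulr1 expr1.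
Qed.

Lemma loop_scalar_left s v : scalar_map (fun u => loop_functional u s v).
Proof.
elim: s => [|[i p] s IHs] c u w /=; first by rewrite mulr0 addr0.
rewrite mulrDl -scalerAl IHs; case: i; rewrite ?quotient_scalar_left; ring.
Qed.

Lemma loop_scalar_right u s : scalar_map (loop_functional u s).
Proof.
elim: s u => [|[i p] s IHs] u c v w /=; first by rewrite mulr0 addr0.
by rewrite mulrDr -scalerAr IHs; case: i; rewrite ?quotient_scalar_right; ring.
Qed.

Lemma loop_cat u s t v : loop_functional u (s ++ t) v =
  loop_functional u s (peval t * v) + loop_functional (u * peval s) t v.
Proof.
elim: s u => [|[i p] s IHs] u /=; first by rewrite peval_nil mulr1 add0r.
by rewrite IHs peval_cat peval_cons !mulrA addrA.
Qed.

(** The left factor of each term is an alternating product of centred elements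
    times a power of [a], whose last factor before this power is not in [a]. *)
Lemma loop_alternating s t : s != [::] -> alternating (s ++ t) ->
  centred phi x (s ++ t) -> loop_functional (peval s) t 1 = 0.
Proof.
elim: t s => [|[i p] t IHt] s s0 alt_st c_st //=.
rewrite -peval_rcons IHt ?cat_rcons //; last by case: (s).
rewrite addr0; case: i alt_st c_st => // alt_st c_st.
rewrite /quotient_functional /poly_functional big1 // => n _.
rewrite big1 ?mulr0 // => i _.
have -> : a ^+ i = ev true 'X^i by rewrite rmorphXn /= horner_algX.
rewrite free_alternating_rcons ?mul0r //; last by case/centred_cat: c_st.
move: alt_st; rewrite -cat_rcons /alternating map_cat => /cat_sorted2[].
by rewrite !map_rcons.
Qed.

Lemma loop_single p :
  phi (a * ev true p) = phi (ev true p) + quotient_functional 1 p 1.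
Proof.
have horner_scalar w : scalar_map (fun p => phi (w * ev true p)).
  by move=> c q r; rewrite horner_alg_comb mulrDr -scalerAr linearP.
pose rhs q := phi (1 * ev true q) + quotient_functional 1 q 1.
rewrite -{2}[ev true p]mul1r -/(rhs p).
apply: (eq_poly_functional (f := fun q => phi (a * ev true q))) => [//||n].
  by move=> c q r; rewrite /rhs horner_scalar quotient_scalar; ring.
rewrite /rhs /quotient_functional poly_functionalXn mul1r rmorphXn /= horner_algX.
rewrite -exprS momentS big_ord_recr /= subnn expr0 phi1 mulr1 addrC; congr (_ + _).
by apply: eq_bigr => i _; rewrite mul1r mulr1.
Qed.

(** By [free_multilinear_eq0] it suffices to treat alternating centred
    products.  If the product starts with [b], all terms vanish.  If it is
    [p (a) Q], the terms that come from [Q] vanish, and those that come from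
    [p (a)] vanish unless [Q] is empty, which is the case of [loop_single]. *)
Lemma loop_letters s :
  phi (a * peval s) = phi (peval s) + loop_functional 1 s 1.
Proof.
pose Phi s := phi (a * peval s) - (phi (peval s) + loop_functional 1 s 1).
apply/eqP; rewrite -subr_eq0 -/(Phi s); apply/eqP; move: s.
apply: (free_multilinear_eq0 phi1 (x := x)).
- rewrite /Phi peval_nil addr0 mulr1 -(expr1 a) momentS big_ord1 subnn expr0.
  by rewrite phi1 mulr1 subrr.
- move=> s i t c p q; rewrite /Phi.
  have := @phi_peval_scalar _ _ phi x a s i t 1 c p q.
  have := @phi_peval_scalar _ _ phi x 1 s i t 1 c p q.
  rewrite !mul1r !mulr1 => -> ->; rewrite !loop_cat /= !peval_cons.
  rewrite horner_alg_comb !(mulrDl, mulrDr) -!(scalerAl, scalerAr).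
  rewrite loop_scalar_left loop_scalar_right.
  by case: i; rewrite ?quotient_scalar; ring.
- move=> s i t; rewrite /Phi !loop_cat /= !peval_cat !peval_cons !rmorph1 !mul1r !mulr1.
  by rewrite quotient_functional1 if_same add0r.
- move=> s i p q t; rewrite /Phi !loop_cat /= !peval_cat !peval_cons !rmorphM /= !mulrA.
  case: i; rewrite ?quotient_functionalM ?add0r // !mulrA; congr (_ - (_ + (_ + _))).
  by rewrite !addrA.
- move=> [//|[i p] s] _ alt_s c_s; rewrite /Phi /=.
  rewrite (free_alternating free_x) // add0r !mulr1 mul1r.
  have -> : ev i p = peval [:: (i, p)] by rewrite peval_cons peval_nil mulr1.
  rewrite loop_alternating // addr0.
  case: i alt_s c_s => alt_s c_s; last first.
    rewrite subr0 -{1}(horner_algX a) (free_alternating_cons phi1 free_x) //.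
  rewrite peval_cons mulrA; case: s alt_s c_s => [|l s] alt_s c_s.
    rewrite peval_nil mulr1 loop_single (c_s (true, p)) ?mem_head // add0r.
    by rewrite subrr.
  have vanish q : phi (ev true q * peval (l :: s)) = 0.
    apply: (free_alternating_cons phi1 free_x) => //.
    by move=> m ms; apply: c_s; rewrite inE ms orbT.
  rewrite -{1}(horner_algX a) -rmorphM vanish sub0r.
  apply/eqP; rewrite oppr_eq0; apply/eqP.
  rewrite /quotient_functional /poly_functional big1 // => n _.
  rewrite big1 ?mulr0 // => i _.
  have -> : a ^+ (n - i) = ev true 'X^(n - i) by rewrite rmorphXn /= horner_algX.
  by rewrite vanish mulr0.
Qed.

End Loop.

(** Formal noncommutative polynomials in two variables.  The loop equation is
    about expressions, as the free difference quotient is not defined on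
    the algebra generated by [a] and [b]. *)
Inductive ncpoly :=
  | NcVar of bool | NcOne | NcAdd of ncpoly & ncpoly | NcMul of ncpoly & ncpoly.

Section Expressions.
Variables (F : fieldType) (A : algType F).
Implicit Types (x : bool -> A) (e : ncpoly).

Fixpoint nceval x e : A :=
  match e with
  | NcVar i => x i
  | NcOne => 1
  | NcAdd e1 e2 => nceval x e1 + nceval x e2
  | NcMul e1 e2 => nceval x e1 * nceval x e2
  end.

Fixpoint ncrev e : ncpoly :=
  match e with
  | NcAdd e1 e2 => NcAdd (ncrev e1) (ncrev e2)
  | NcMul e1 e2 => NcMul (ncrev e2) (ncrev e1)
  | _ => e
  end.

Fixpoint ncwords e : seq (seq (bool * {poly F})) :=
  match e with
  | NcVar i => [:: [:: (i, 'X)]]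
  | NcOne => [:: [::]]
  | NcAdd e1 e2 => ncwords e1 ++ ncwords e2
  | NcMul e1 e2 => [seq s ++ t | s <- ncwords e1, t <- ncwords e2]
  end.

Lemma nceval_words x e : nceval x e = \sum_(s <- ncwords e) peval x s.
Proof.
elim: e => [i||e1 IH1 e2 IH2|e1 IH1 e2 IH2] /=.
- by rewrite big_seq1 peval_cons peval_nil mulr1 horner_algX.
- by rewrite big_seq1 peval_nil.
- by rewrite IH1 IH2 big_cat.
rewrite IH1 IH2 big_allpairs_dep mulr_suml; apply: eq_bigr => s _.
by rewrite mulr_sumr; apply: eq_bigr => t _; rewrite peval_cat.
Qed.

Lemma nceval_rev_words x e :
  nceval x (ncrev e) = \sum_(s <- ncwords e) peval x (rev s).
Proof.
elim: e => [i||e1 IH1 e2 IH2|e1 IH1 e2 IH2] /=.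
- by rewrite big_seq1 peval_cons peval_nil mulr1 horner_algX.
- by rewrite big_seq1 peval_nil.
- by rewrite IH1 IH2 big_cat.
rewrite IH1 IH2 big_allpairs_dep mulr_sumr; apply: eq_bigr => s _.
by rewrite mulr_suml; apply: eq_bigr => t _; rewrite rev_cat peval_cat.
Qed.

Variable phi : {scalar A}.
Hypothesis phi1 : phi 1 = 1.
Variable x : bool -> A.
Hypothesis free_x : freely_independent phi x.
Local Notation ev := (nceval x).

Lemma phi_nceval_rev e : phi (ev (ncrev e)) = phi (ev e).
Proof.
rewrite nceval_rev_words nceval_words !linear_sum.
by apply: eq_bigr => s _; rewrite free_moment_rev.
Qed.

Lemma phi_nceval_swap e : (forall n, phi (x true ^+ n) = phi (x false ^+ n)) ->
  phi (nceval (x \o negb) e) = phi (ev e).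
Proof.
move=> moments; rewrite !nceval_words !linear_sum; apply: eq_bigr => s _.
apply: free_moment_eq; rewrite //; first exact: freely_independent_swap.
by case=> n /=; rewrite moments.
Qed.

Hypothesis momentS : forall n,
  phi (x true ^+ n.+1)
  = \sum_(i < n.+1) phi (x true ^+ i) * phi (x true ^+ (n - i)).

Fixpoint ncloop u e v : F :=
  match e with
  | NcVar i => if i then phi u * phi (x true * v) else 0
  | NcOne => 0
  | NcAdd e1 e2 => ncloop u e1 v + ncloop u e2 v
  | NcMul e1 e2 => ncloop u e1 (ev e2 * v) + ncloop (u * ev e1) e2 v
  end.

Lemma ncloop_words u e v :
  ncloop u e v = \sum_(s <- ncwords e) loop_functional phi x u s v.
Proof.
elim: e u v => [i||e1 IH1 e2 IH2|e1 IH1 e2 IH2] u v /=.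
- rewrite big_seq1 /= addr0 peval_nil mul1r.
  by case: i; rewrite ?quotient_functionalX.
- by rewrite big_seq1.
- by rewrite IH1 IH2 big_cat.
rewrite IH1 IH2 big_allpairs_dep.
under [RHS]eq_bigr => s _ do under eq_bigr => t _ do rewrite loop_cat.
under [RHS]eq_bigr => s _ do rewrite big_split /=.
rewrite big_split /=; congr (_ + _).
  apply: eq_bigr => s _; rewrite nceval_words mulr_suml.
  exact: (scalar_map_sum _ _ (loop_scalar_right phi x u s)).
rewrite exchange_big; apply: eq_bigr => t _ /=; rewrite nceval_words mulr_sumr.
exact: (scalar_map_sum _ _ (loop_scalar_left phi x t v)).
Qed.

Lemma loop_equation e : phi (x true * ev e) = phi (ev e) + ncloop 1 e 1.
Proof.
rewrite nceval_words ncloop_words mulr_sumr !linear_sum -big_split.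
by apply: eq_bigr => s _; rewrite loop_letters.
Qed.

End Expressions.

(** * Composition of formal power series *)

Section Composition.
Variable F : fieldType.
Implicit Types (f g h : fps F) (c : F).

Lemma coef_fps_sum (I : Type) (r : seq I) (P : pred I) (E : I -> fps F) n :
  (\sum_(i <- r | P i) E i) n = \sum_(i <- r | P i) E i n.
Proof. by elim/big_rec2: _ => [|i x f _ <-]; rewrite ?coef_fps0. Qed.

Lemma coef_fpsM0 f g : (f * g) 0%N = f 0%N * g 0%N.
Proof. by rewrite coef_fpsM big_ord1. Qed.

Lemma coef_fpsZ c f n : (fps_const c * f) n = c * f n.
Proof.
rewrite coef_fpsM big_ord_recl subn0 big1 ?addr0 // => i _.
by rewrite mul0r.
Qed.

Lemma fps_const_zmod_morphism : zmod_morphism (@fps_const F).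
Proof.
by move=> x y; apply/fpsP => -[|n] //; rewrite coef_fpsD coef_fpsN /= subrr.
Qed.

Lemma fps_const_monoid_morphism : monoid_morphism (@fps_const F).
Proof.
by split=> // x y; apply/fpsP => n; rewrite coef_fpsZ; case: n => //= n; rewrite mulr0.
Qed.

HB.instance Definition _ :=
  GRing.isZmodMorphism.Build F (fps F) (@fps_const F) fps_const_zmod_morphism.
HB.instance Definition _ :=
  GRing.isMonoidMorphism.Build F (fps F) (@fps_const F) fps_const_monoid_morphism.

Lemma fps_natE n : (n%:R : fps F) = fps_const n%:R.
Proof. by rewrite rmorph_nat. Qed.

Lemma coef_fpsXn_lt g k n : g 0%N = 0 -> (n < k)%N -> (g ^+ k) n = 0.
Proof.
move=> g0; elim: k n => // k IHk n ltnk; rewrite exprS coef_fpsM big_ord_recl g0.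
rewrite mul0r add0r big1 // => i _; rewrite IHk ?mulr0 //.
by rewrite lift0; have := ltn_ord i; lia.
Qed.

Lemma coef_fpsXn_diag g k : g 0%N = 0 -> (g ^+ k) k = g 1%N ^+ k.
Proof.
move=> g0; elim: k => [|k IHk]; first by rewrite coef_fps1.
rewrite exprS coef_fpsM !big_ord_recl g0 mul0r add0r /= subSS subn0 IHk exprS.
rewrite big1 ?addr0 // => i _; rewrite coef_fpsXn_lt ?mulr0 // /bump.
by have := ltn_ord i; lia.
Qed.

Definition fps_eval g (p : {poly F}) : fps F := (map_poly (@fps_const F) p).[g].

(** A coefficient of [f (g)] only depends on finitely many coefficients of
    [f].  It can be computed on a polynomial, for which composition with [g] is
    an evaluation, hence a ring morphism. *)
Lemma fps_compE f g n (p : {poly F}) : g 0%N = 0 ->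
  (forall k, (k <= n)%N -> p`_k = f k) -> fps_comp f g n = fps_eval g p n.
Proof.
move=> g0 pf; pose N := maxn n.+1 (size p).
rewrite /fps_eval (horner_coef_wide (n := N)); last first.
  by rewrite size_map_poly leq_maxr.
rewrite coef_fps_sum [LHS]/=.
rewrite (big_ord_widen N (fun k => f k * (g ^+ k) n)) ?leq_maxl //.
rewrite big_mkcond; apply: eq_bigr => k _; rewrite coef_map coef_fpsZ.
by rewrite ltnS; case: leqP => [/pf->//|ltk]; rewrite coef_fpsXn_lt ?mulr0.
Qed.

Lemma fps_compM f1 f2 g : g 0%N = 0 ->
  fps_comp (f1 * f2) g = fps_comp f1 g * fps_comp f2 g.
Proof.
move=> g0; apply/fpsP => n.
rewrite (@fps_compE _ _ _ (fps_trunc n.+1 f1 * fps_trunc n.+1 f2)) //; last first.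
  by move=> k lekn; rewrite -fps_mul_trunc.
rewrite /fps_eval rmorphM hornerM !coef_fpsM; apply: eq_bigr => i _.
congr (_ * _); symmetry; apply: fps_compE => // k lek; rewrite coef_poly ifT //.
  by have := ltn_ord i; lia.
by lia.
Qed.

Lemma fps_compD f1 f2 g : fps_comp (f1 + f2) g = fps_comp f1 g + fps_comp f2 g.
Proof.
apply/fpsP => n; rewrite coef_fpsD [RHS]/= -big_split; apply: eq_bigr => k _.
by rewrite coef_fpsD mulrDl.
Qed.

Lemma fps_compN f g : fps_comp (- f) g = - fps_comp f g.
Proof.
apply/fpsP => n; rewrite coef_fpsN [RHS]/= -sumrN; apply: eq_bigr => k _.
by rewrite coef_fpsN mulNr.
Qed.

Lemma fps_comp_const c g : fps_comp (fps_const c) g = fps_const c.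
Proof.
apply/fpsP => n; rewrite [LHS]/= big_ord_recl big1 => [|i _]; last by rewrite mul0r.
by rewrite expr0 coef_fps1 addr0; case: n => [|n]; rewrite ?mulr1 ?mulr0.
Qed.

Lemma fps_comp_nat n g : fps_comp n%:R g = n%:R.
Proof. by rewrite fps_natE fps_comp_const. Qed.

Lemma fps_compX g : g 0%N = 0 -> fps_comp fpsX g = g.
Proof.
move=> g0; apply/fpsP => -[|n] /=; first by rewrite big_ord1 mul0r g0.
rewrite !big_ord_recl big1 => [|i _]; rewrite /= ?mul0r //.
by rewrite mul1r add0r addr0.
Qed.

Lemma fps_comp0 f g : fps_comp f g 0%N = f 0%N.
Proof. by rewrite /= big_ord1 expr0 coef_fps1 mulr1. Qed.

Lemma fps_compXn f g k : g 0%N = 0 -> fps_comp (f ^+ k) g = fps_comp f g ^+ k.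
Proof.
move=> g0; elim: k => [|k IHk]; last by rewrite !exprS fps_compM // IHk.
by rewrite !expr0 (fps_comp_nat 1).
Qed.

Lemma fps_compA f g h : g 0%N = 0 -> h 0%N = 0 ->
  fps_comp (fps_comp f g) h = fps_comp f (fps_comp g h).
Proof.
move=> g0 h0; apply/fpsP => n /=.
transitivity (\sum_(k < n.+1) \sum_(j < n.+1) f j * (g ^+ j) k * (h ^+ k) n).
  apply: eq_bigr => k _; rewrite mulr_suml.
  rewrite (big_ord_widen n.+1 (fun j => f j * (g ^+ j) k * (h ^+ k) n)) //.
  rewrite big_mkcond; apply: eq_bigr => j _; rewrite ltnS.
  by case: leqP => // ltkj; rewrite coef_fpsXn_lt // mulr0 mul0r.
rewrite exchange_big; apply: eq_bigr => j _ /=.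
rewrite -fps_compXn //= mulr_sumr.
by apply: eq_bigr => k _; rewrite mulrA.
Qed.

(** The coefficient of index [n] of [f (g)] is [f_n g_1^n] plus terms that
    depend only on the previous coefficients of [f]. *)
Lemma fps_comp_inj g : g 0%N = 0 -> g 1%N != 0 ->
  injective (fun f => fps_comp f g).
Proof.
move=> g0 g1 f1 f2 /= E; apply/fpsP => n.
elim/ltn_ind: n => n IHn; have /fpsP/(_ n) := E; rewrite /= !big_ord_recr /=.
rewrite coef_fpsXn_diag //; under eq_bigr => i _ do rewrite IHn //.
by move/addrI/mulIf; apply; rewrite expf_neq0.
Qed.

Lemma coef_fpsXM0 f : (fpsX * f) 0%N = 0.
Proof. by rewrite coef_fpsM0 mul0r. Qed.

Lemma coef_fpsXMS f n : (fpsX * f) n.+1 = f n.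
Proof.
rewrite coef_fpsM !big_ord_recl big1 => [|i _]; rewrite /= ?mul0r //.
by rewrite mul1r add0r addr0 subSS subn0.
Qed.

Lemma coef_fpsXn k n : ((fpsX : fps F) ^+ k) n = (n == k)%:R.
Proof.
elim: k n => [|k IHk] [|n]; rewrite ?coef_fps1 // exprS ?coef_fpsXM0 //.
by rewrite coef_fpsXMS IHk.
Qed.

Lemma fps_comp_fpsX f : fps_comp f fpsX = f.
Proof.
apply/fpsP => n /=; rewrite big_ord_recr big1 => [|i _] /=.
  by rewrite coef_fpsXn eqxx mulr1 add0r.
by rewrite coef_fpsXn gtn_eqF ?mulr0.
Qed.

(** From [f (g) = X] follows [(g (f)) (g) = g (f (g)) = g = X (g)], and
    composition with [g] is injective. *)
Lemma fps_comp_inverse_right f g : f 0%N = 0 -> g 0%N = 0 -> g 1%N != 0 ->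
  fps_comp f g = fpsX -> fps_comp_inverse g f.
Proof.
move=> f0 g0 g1 fg; split=> //; apply: (fps_comp_inj g0 g1) => /=.
by rewrite fps_compA // fg fps_compX // fps_comp_fpsX.
Qed.

End Composition.

(** * Solution of the system of loop equations *)

Section Elimination.
Variable C : comUnitRingType.

Lemma eq_of_subr (a b e : C) : e = 0 -> a - b = e -> a = b.
Proof. by move=> -> /eqP; rewrite subr_eq0 => /eqP. Qed.

(** All the series are multiplied by [z], so that [z] only occurs through [N],
    which stands for [z M].  The hypotheses are linear in each of [N], [Q],
    [S], [T] and [U] separately, which are eliminated one after the other; what
    remains is [R (1 - P) = 2 P (1 + P R)].  Each step exhibits the claim as a
    combination of relations known to vanish. *)
Lemma scaled_loop_system (m N P Q R S T U : C) :
    1 - P \is a GRing.unit ->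
    m - 2 * Q = 0 ->
    P * (1 - P) - N * (1 + Q) = 0 ->
    Q * (1 - P) - P * (1 + R) = 0 ->
    R * (1 - P) - (P + N * (1 + S)) = 0 ->
    S * (1 - P) - (P + T + R ^+ 2) = 0 ->
    T * (1 - P) - (P + N * U) = 0 ->
    U * (1 - P) - R * (1 + T) = 0 ->
  m * ((1 - 2 * P) * (1 + P)) = 2 * P * (1 + 2 * P).
Proof.
move=> Ud Zm ZP ZQ ZR ZS ZT ZU.
have ZN : N * (1 + P * R) - P * (1 - P) ^+ 2 = 0.
  apply: (@eq_of_subr _ _ (- (1 - P) * (P * (1 - P) - N * (1 + Q))
                       - N * (Q * (1 - P) - P * (1 + R)))).
    by rewrite ZP ZQ; ring.
  by ring.
have ZT' : T * (1 - P) - P * (1 + R) = 0.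
  apply: (mulrI Ud); apply: (@eq_of_subr _ _
    ((1 + P * R) * ((1 - P) * (T * (1 - P) - (P + N * U))
                    + N * (U * (1 - P) - R * (1 + T)))
     + (R * (1 + T)) * (N * (1 + P * R) - P * (1 - P) ^+ 2))).
    by rewrite ZT ZU ZN; ring.
  by ring.
have ZS' : (1 - P) ^+ 2 * (1 + S) - (1 + P * R + (1 - P) * R ^+ 2) = 0.
  apply: (@eq_of_subr _ _ ((1 - P) * (S * (1 - P) - (P + T + R ^+ 2))
                       + (T * (1 - P) - P * (1 + R)))).
    by rewrite ZS ZT'; ring.
  by ring.
have ZR' : R * (1 - P) - 2 * P * (1 + P * R) = 0.
  apply: (@eq_of_subr _ _ ((1 + P * R) * (R * (1 - P) - (P + N * (1 + S)))
                       + (1 + S) * (N * (1 + P * R) - P * (1 - P) ^+ 2)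
     + P * ((1 - P) ^+ 2 * (1 + S) - (1 + P * R + (1 - P) * R ^+ 2)))).
    by rewrite ZR ZN ZS'; ring.
  by ring.
apply: (mulrI Ud); apply: (@eq_of_subr _ _
  ((1 - 2 * P) * (1 + P) * ((1 - P) * (m - 2 * Q)
      + 2 * (Q * (1 - P) - P * (1 + R)))
   + 2 * P * (R * (1 - P) - 2 * P * (1 + P * R)))).
  by rewrite Zm ZQ ZR'; ring.
by ring.
Qed.

Lemma loop_system_solution (z M p q r s t u : C) :
    1 - z * p \is a GRing.unit ->
    M = 1 + z * (q + q) ->
    p = M + z * (M * q + p * p) ->
    q = p + z * (p * q + r * p) ->
    r = p + M + z * (M * s + p * r) ->
    s = t + p + z * (p * s + r * r) ->
    t = p + z * (M * u + p * t) ->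
    u = r + z * (p * u + r * t) ->
  let m := M - 1 in let P := z * p in let K := (1 - 2 * P) * (1 + P) in
  m * K = 2 * P * (1 + 2 * P) /\ z * (m + 1) * (m + 2) = 2 * P * (1 - P).
Proof.
move=> Ud EM Ep Eq Er Es Et Eu m P K.
have scaled x y e : x = y -> z * (x - y) = e -> e = 0.
  by move=> -> <-; rewrite subrr mulr0.
have Zm : m - 2 * (z * q) = 0 by rewrite /m EM; ring.
have ZP : P * (1 - P) - z * M * (1 + z * q) = 0.
  by apply: (scaled _ _ _ Ep); rewrite /P; ring.
have ZQ : z * q * (1 - P) - P * (1 + z * r) = 0.
  by apply: (scaled _ _ _ Eq); rewrite /P; ring.
split.
  apply: (@scaled_loop_system m (z * M) P
            (z * q) (z * r) (z * s) (z * t) (z * u)) => //.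
  - by apply: (scaled _ _ _ Er); rewrite /P; ring.
  - by apply: (scaled _ _ _ Es); rewrite /P; ring.
  - by apply: (scaled _ _ _ Et); rewrite /P; ring.
  - by apply: (scaled _ _ _ Eu); rewrite /P; ring.
apply: (@eq_of_subr _ _ (z * (m + 1) * (m - 2 * (z * q))
                     - 2 * (P * (1 - P) - z * M * (1 + z * q)))).
  by rewrite Zm ZP; ring.
by rewrite /m; ring.
Qed.

(** The hypothesis on [m K] amounts to [(m + 2) K = 2], which rationally
    parametrizes the conic [y^2 = (m + 2) (9 m + 2)] by [P]. *)
Lemma anticommutator_identities (z m P : C) :
  let K := (1 - 2 * P) * (1 + P) in
  K \is a GRing.unit ->
  m * K = 2 * P * (1 + 2 * P) -> z * (m + 1) * (m + 2) = 2 * P * (1 - P) ->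
  ((1 + 4 * P) * (m + 2)) ^+ 2 = (m + 2) * (9 * m + 2) /\
  - 7 * m - 6 + 3 * ((1 + 4 * P) * (m + 2)) = z * (4 * (m + 2) ^+ 2 * (m + 1)).
Proof.
move=> K UK EmK Ez.
have ZmK : m * K - 2 * P * (1 + 2 * P) = 0 by rewrite EmK subrr.
have Zz : z * (m + 1) * (m + 2) - 2 * P * (1 - P) = 0 by rewrite Ez subrr.
split; apply: (mulIr UK).
  apply: (@eq_of_subr _ _ ((m + 2) * ((1 + 4 * P) ^+ 2 - 9)
                       * (m * K - 2 * P * (1 + 2 * P)))).
    by rewrite ZmK mulr0.
  by rewrite /K; ring.
apply: (@eq_of_subr _ _ ((- 7 + 3 * (1 + 4 * P) - 8 * P * (1 - P))
                       * (m * K - 2 * P * (1 + 2 * P))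
   - 4 * (m + 2) * K * (z * (m + 1) * (m + 2) - 2 * P * (1 - P)))).
  by rewrite ZmK Zz !mulr0 subr0.
by rewrite /K; ring.
Qed.

End Elimination.

Section Inverse.
Variable F : fieldType.
Hypothesis F2 : 2 != 0 :> F.

(** The square root composed with [M - 1] is identified by its square and its
    constant term. *)
Lemma anticommutator_comp_inverse (M p q r s t u : fps F) :
    M = 1 + fpsX * (q + q) ->
    p = M + fpsX * (M * q + p * p) ->
    q = p + fpsX * (p * q + r * p) ->
    r = p + M + fpsX * (M * s + p * r) ->
    s = t + p + fpsX * (p * s + r * r) ->
    t = p + fpsX * (M * u + p * t) ->
    u = r + fpsX * (p * u + r * t) ->
  let z : fps F := fpsX in
  fps_comp_inverse (M - 1)
    ((- 7 * z - 6 + 3 * fps_sqrt 2 ((z + 2) * (9 * z + 2)))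
       / (4 * (z + 2) ^+ 2 * (z + 1))).
Proof.
move=> EM Ep Eq Er Es Et Eu z; set m := M - 1; set P := z * p.
have P0 : P 0%N = 0 by rewrite coef_fpsXM0.
have M0 : M 0%N = 1 by rewrite EM coef_fpsD coef_fpsXM0 addr0.
have m0 : m 0%N = 0 by rewrite /m coef_fpsD coef_fpsN M0 subrr.
have m1 : m 1%N = 2.
  rewrite /m coef_fpsD coef_fpsN EM coef_fpsD coef_fpsXMS coef_fpsD.
  rewrite Eq coef_fpsD coef_fpsXM0 Ep coef_fpsD coef_fpsXM0 M0 coef_fps1.
  by ring.
have nat0 n : (n%:R : fps F) 0%N = n%:R by rewrite fps_natE.
have Ud : 1 - P \is a GRing.unit.
  by rewrite fps_unitE coef_fpsD coef_fpsN P0 subr0 oner_eq0.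
have UK : (1 - 2 * P) * (1 + P) \is a GRing.unit.
  rewrite fps_unitE coef_fpsM0 !coef_fpsD coef_fpsN coef_fpsM0 P0.
  by rewrite mulr0 subr0 addr0 mulr1 oner_eq0.
have [EmK Ez] := loop_system_solution Ud EM Ep Eq Er Es Et Eu.
have [Esqrt Enum] := anticommutator_identities UK EmK Ez.
set f := _ / _; set D := 4 * (z + 2) ^+ 2 * (z + 1).
set rad := (z + 2) * (9 * z + 2) in f *.
have D0 : D 0%N = 2 ^+ 4.
  rewrite /D !fps_natE expr2 !coef_fpsM0 !coef_fpsD /= !add0r.
  by ring.
have UD : D \is a GRing.unit by rewrite fps_unitE D0 expf_neq0.
have fD : f * D = - 7 * z - 6 + 3 * fps_sqrt 2 rad by rewrite divrK.
have rad0 : 2 ^+ 2 = rad 0%N :> F.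
  by rewrite /rad !fps_natE coef_fpsM0 !coef_fpsD coef_fpsM0 /= mulr0 !add0r expr2.
have F22 : 2 * 2 != 0 :> F by rewrite mulf_neq0.
have f0 : f 0%N = 0.
  apply: (mulIf (_ : D 0%N != 0)); first by rewrite -fps_unitE.
  rewrite -coef_fpsM0 fD !fps_natE !(coef_fpsD, coef_fpsN, coef_fpsM0) fps_sqrt0 /=.
  by ring.
apply: fps_comp_inverse_right; rewrite ?m1 //.
have cD : fps_comp D m = 4 * (m + 2) ^+ 2 * (m + 1).
  rewrite !(fps_compM, fps_compD, fps_compXn, fps_comp_nat, fps_compX) //.
  by rewrite (fps_comp_nat 1).
have csqrt : fps_comp (fps_sqrt 2 rad) m = (1 + 4 * P) * (m + 2).
  have Erad : fps_comp rad m = (m + 2) * (9 * m + 2).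
    by rewrite !(fps_compM, fps_compD, fps_comp_nat, fps_compX).
  have comp_rad0 : 2 ^+ 2 = fps_comp rad m 0%N by rewrite fps_comp0.
  transitivity (fps_sqrt 2 (fps_comp rad m)).
    by apply: fps_sqrt_uniq; rewrite // -?fps_compXn ?fps_sqrt_sqr ?fps_comp0.
  symmetry; apply: fps_sqrt_uniq => //; first by rewrite Erad.
  rewrite coef_fpsM0 coef_fpsD m0 nat0 add0r coef_fpsD coef_fpsM0 P0 mulr0.
  by rewrite coef_fps1 addr0 mul1r.
have UcD : fps_comp D m \is a GRing.unit.
  by rewrite fps_unitE fps_comp0 D0 expf_neq0.
apply: (mulIr UcD); rewrite -fps_compM // fD cD.
rewrite fps_compD [fps_comp (_ - _) m]fps_compD 2?fps_compM // 2!fps_compN.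
by rewrite fps_compX // 3!fps_comp_nat csqrt Enum.
Qed.

End Inverse.

(** * The resolvent series of the anticommutator *)

Section Anticommutator.
Variables (F : fieldType) (A : algType F) (phi : {scalar A}).
Hypothesis phi1 : phi 1 = 1.
Variable x : bool -> A.
Hypothesis free_x : freely_independent phi x.
Hypothesis momentS : forall n,
  phi (x true ^+ n.+1)
  = \sum_(i < n.+1) phi (x true ^+ i) * phi (x true ^+ (n - i)).
Hypothesis moments : forall n, phi (x true ^+ n) = phi (x false ^+ n).
Local Notation a := (x true).
Local Notation b := (x false).
Local Notation w := (a * b + b * a).
Local Notation ev := (nceval x).
Implicit Types (u v : A) (e f : ncpoly).

Definition resolvent_series u v : fps F := Fps (fun n => phi (u * w ^+ n * v)).
Local Notation S := resolvent_series.

Definition ncanti : ncpoly :=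
  NcAdd (NcMul (NcVar true) (NcVar false)) (NcMul (NcVar false) (NcVar true)).
(** Powers are built by multiplication on the right, so that [ncloop] of a
    power peels off its last factor. *)
Definition ncantiX n : ncpoly := iter n (NcMul^~ ncanti) NcOne.

Lemma nceval_antiX n : ev (ncantiX n) = w ^+ n.
Proof. by elim: n => //= n ->; rewrite exprSr. Qed.

Lemma nceval_antiX_swap n : nceval (x \o negb) (ncantiX n) = w ^+ n.
Proof. by elim: n => //= n ->; rewrite exprSr [a * b + _]addrC. Qed.

Lemma nceval_antiX_rev n : ev (ncrev (ncantiX n)) = w ^+ n.
Proof. by elim: n => //= n ->; rewrite exprS [a * b + _]addrC. Qed.

Lemma resolvent_series_swap e f :
  S (nceval (x \o negb) e) (nceval (x \o negb) f) = S (ev e) (ev f).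
Proof.
apply/fpsP => n /=.
have := phi_nceval_swap phi1 free_x (NcMul (NcMul e (ncantiX n)) f) moments.
by rewrite /= nceval_antiX nceval_antiX_swap.
Qed.

Lemma resolvent_series_rev e : S (ev e) 1 = S 1 (ev (ncrev e)).
Proof.
apply/fpsP => n /=; have := phi_nceval_rev phi1 free_x (NcMul e (ncantiX n)).
by rewrite /= nceval_antiX_rev nceval_antiX mulr1 mul1r.
Qed.

Lemma ncloop_antiX u n v : ncloop phi x u (ncantiX n) v =
  \sum_(k < n) (phi (u * w ^+ k * 1) * phi (a * b * w ^+ (n.-1 - k) * v)
                + phi (u * w ^+ k * b) * phi (a * w ^+ (n.-1 - k) * v)).
Proof.
elim: n v => [|n IHn] v; first by rewrite big_ord0.
rewrite [LHS]/= IHn nceval_antiX big_ord_recr /= subnn expr0 !mulr1 addr0 add0r.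
congr (_ + _); last by rewrite !mulrA.
apply: eq_bigr => k _; have -> : (n - k)%N = (n.-1 - k).+1 by have := ltn_ord k; lia.
by rewrite exprSr !mulrA.
Qed.

(** The loop equation for [Q = u w^n v], when [u] does not contain [a].  A
    letter [a] inside [w^n] belongs to a factor [a b] or [b a], and cuts [w^n]
    into two smaller powers: this gives the two products of series.  The last
    term accounts for the letters [a] of [v]. *)
Lemma resolvent_series_loop e f : (forall v, ncloop phi x 1 e v = 0) ->
  S (a * ev e) (ev f) =
    S (ev e) (ev f)
    + fpsX * (S (ev e) 1 * S (a * b) (ev f) + S (ev e) b * S a (ev f))
    + Fps (fun n => ncloop phi x (ev e * w ^+ n) f 1).
Proof.
move=> loop_e; apply/fpsP => n; rewrite 2!coef_fpsD [LHS]/=.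
have loop := loop_equation phi1 free_x momentS (NcMul e (NcMul (ncantiX n) f)).
rewrite /= loop_e add0r !mul1r !mulr1 nceval_antiX !mulrA in loop; rewrite loop.
rewrite -addrA; congr (_ + (_ + _)); rewrite ncloop_antiX.
case: n {loop} => [|n]; first by rewrite big_ord0 coef_fpsXM0.
by rewrite coef_fpsXMS coef_fpsD !coef_fpsM -big_split.
Qed.

Lemma phi_var : phi a = 1.
Proof. by rewrite -(expr1 a) momentS big_ord1 subnn expr0 phi1 mulr1. Qed.

Lemma anticommutator_series_inverse :
  2 != 0 :> F ->
  let z : fps F := fpsX in
  fps_comp_inverse (moment_series phi w)
    ((- 7 * z - 6 + 3 * fps_sqrt 2 ((z + 2) * (9 * z + 2)))
       / (4 * (z + 2) ^+ 2 * (z + 1))).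
Proof.
move=> F2.
have -> : moment_series phi w = S 1 1 - 1.
  apply/fpsP => -[|n]; rewrite coef_fpsD coef_fpsN coef_fps1 /= ?mul1r ?mulr1.
    by rewrite phi1 subrr.
  by rewrite subr0.
have Sb1 : S b 1 = S a 1 := resolvent_series_swap (NcVar true) NcOne.
have S1a : S 1 a = S a 1 by rewrite (resolvent_series_rev (NcVar true)).
have S1b : S 1 b = S a 1.
  by rewrite -S1a; exact: resolvent_series_swap NcOne (NcVar true).
have Sbb : S b b = S a a := resolvent_series_swap (NcVar true) (NcVar true).
have Sba : S b a = S a b := resolvent_series_swap (NcVar true) (NcVar false).
have Sba1 : S (b * a) 1 = S (a * b) 1 :=
  resolvent_series_swap (NcMul (NcVar true) (NcVar false)) NcOne.
have loop1 v : ncloop phi x 1 NcOne v = 0 by [].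
have loopb v : ncloop phi x 1 (NcVar false) v = 0 by [].
have end0 u f : (forall v, ncloop phi x v f 1 = 0) ->
    Fps (fun n => ncloop phi x (u * w ^+ n) f 1) = 0.
  by move=> f0; apply/fpsP => n; rewrite coef_fps0 /= f0.
have enda u : Fps (fun n => ncloop phi x (u * w ^+ n) (NcVar true) 1) = S u 1.
  by apply/fpsP => n /=; rewrite !mulr1 phi_var mulr1.
apply: (@anticommutator_comp_inverse F F2 (S 1 1) (S a 1) (S (a * b) 1) (S a a)
          (S (a * b) a) (S a b) (S (a * b) b)).
- apply/fpsP => -[|n]; rewrite coef_fpsD coef_fps1.
    by rewrite coef_fpsXM0 /= !mulr1 phi1 addr0.
  rewrite coef_fpsXMS coef_fpsD -{2}Sba1 /= !mulr1 mul1r add0r.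
  by rewrite exprS mulrDl linearD.
- have := @resolvent_series_loop NcOne NcOne loop1.
  by rewrite end0 //= addr0 mulr1 S1b.
- have := @resolvent_series_loop (NcVar false) NcOne loopb.
  by rewrite end0 //= addr0 Sb1 Sbb.
- have := @resolvent_series_loop NcOne (NcVar true) loop1.
  by rewrite enda /= mulr1 S1a S1b addrAC.
- have := @resolvent_series_loop (NcVar false) (NcVar true) loopb.
  by rewrite enda /= Sba Sb1 Sbb addrAC.
- have := @resolvent_series_loop NcOne (NcVar false) loop1.
  by rewrite end0 //= addr0 mulr1 S1b.
- have := @resolvent_series_loop (NcVar false) (NcVar false) loopb.
  by rewrite end0 //= addr0 Sbb Sb1.
Qed.

End Anticommutator.

Local Open Scope complex_scope.

Theorem theorem1p7 (R : realType) (A : algType R[i]) (phi : {scalar A})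
    (phi1 : phi 1 = 1) (a b : A)
    (ha : free_poisson phi 1 a) (hb : free_poisson phi 1 b)
    (hab : free_pair phi a b) :
  let z : fps R[i] := fpsX in
  fps_comp_inverse (moment_series phi (a * b + b * a))
    ((- 7 * z - 6 + 3 * fps_sqrt 2 ((z + 2) * (9 * z + 2)))
       / (4 * (z + 2) ^+ 2 * (z + 1))).
Proof.
apply: (anticommutator_series_inverse phi1 hab).
- exact: free_poisson_momentS.
- by move=> n; rewrite !free_poisson_moment.
- by rewrite Num.Theory.pnatr_eq0.
Qed.
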